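(* For the Combinatorial Auctions Prophet Secretary problem (defined in the context) with XOS valuations, there exists an online allocation algorithm whose expected welfare is at least $(1-1/e)\cdot\mathbb{E}[\mathrm{OPT}]$, where $\mathrm{OPT}$ is the maximum over all partitions of the items into disjoint bundles $S_1,\dots,S_n$ of $\sum_i v_i(S_i)$ for the realized valuations.
   Context: There are $n$ buyers and a set $M$ of $m$ indivisible items. Buyer $i$ has a random valuation $v_i:2^M\to\mathbb{R}_{\ge 0}$ drawn from a known distribution (with finite support), independently across buyers; every valuation in the support is XOS, i.e. of the form $v(S)=\max_{1\le \ell\le k}A_\ell(S)$ for nonnegative additive functions $A_1,\dots,A_k$. Each buyer $i$ arrives at an independent time $T_i$ uniform on $[0,1]$ (equivalently, in a uniformly random order). When a buyer arrives her valuation is revealed and the algorithm must immediately and irrevocably assign her a subset of the still-unassigned items. The welfare is $\sum_i v_i(\text{bundle assigned to } i)$; expectations are over valuations, arrival order and the algorithm's randomness. *)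

(* Defs.v *)
From Stdlib Require Import Reals.
From mathcomp Require Import all_boot perm.
Set Implicit Arguments. Unset Strict Implicit. Unset Printing Implicit Defensive.

Local Open Scope R_scope.

Definition valuation (m : nat) := {set 'I_m} -> R.

Definition additive_val (m : nat) (w : 'I_m -> R) : valuation m :=
  fun S => (\big[Rplus/R0]_(j in S) w j)%BIG.

Definition XOS (m : nat) (v : valuation m) : Prop :=
  exists ws : seq ('I_m -> R),
    ws <> [::] /\
    (forall w, List.In w ws -> forall j, 0 <= w j) /\
    (forall S, (forall w, List.In w ws -> additive_val w S <= v S) /\
               (exists2 w, List.In w ws & additive_val w S = v S)).

(* History seen by an online algorithm: the buyers that already arrived,
   in arrival order, together with their revealed valuations. *)
Definition history (n m : nat) := seq ('I_n * valuation m)%type.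

(* A (randomised) online algorithm with random seed in a finite type Seed:
   given the seed, the history, the identity and valuation of the arriving
   buyer and the set of still-unassigned items, it chooses a bundle
   (intersected with the unassigned items, so the bundle is always feasible). *)
Definition online_alg (n m : nat) (Seed : finType) :=
  Seed -> history n m -> 'I_n -> valuation m -> {set 'I_m} -> {set 'I_m}.

Definition run_step (n m : nat) (Seed : finType) (alg : online_alg n m Seed)
    (s : Seed) (sigma : {perm 'I_n}) (vals : 'I_n -> valuation m)
    (st : history n m * {set 'I_m} * R) (k : 'I_n) :
    history n m * {set 'I_m} * R :=
  let: (h, rem, w) := st in
  let i := sigma k in
  let v := vals i in
  let B := (alg s h i v rem :&: rem)%SET in
  (rcons h (i, v), (rem :\: B)%SET, w + v B).

Definition run_welfare (n m : nat) (Seed : finType) (alg : online_alg n m Seed)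
    (s : Seed) (sigma : {perm 'I_n}) (vals : 'I_n -> valuation m) : R :=
  (foldl (run_step alg s sigma vals) ([::], [set: 'I_m]%SET, R0)
         (enum 'I_n)).2.

(* Offline optimum: max over all allocations of disjoint bundles
   S_i = {j | a j = Some i} (items may stay unallocated). *)
Definition OPT (n m : nat) (vals : 'I_n -> valuation m) : R :=
  \big[Rmax/R0]_(a : {ffun 'I_m -> option 'I_n})
     \big[Rplus/R0]_(i : 'I_n) (vals i [set j | a j == Some i]%SET).

Definition prof_prob (n : nat) (V : finType) (p : 'I_n -> V -> R)
    (prof : {ffun 'I_n -> V}) : R :=
  \big[Rmult/R1]_(i : 'I_n) p i (prof i).

Definition exp_OPT (n m : nat) (V : finType) (p : 'I_n -> V -> R)
    (val : V -> valuation m) : R :=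
  \big[Rplus/R0]_(prof : {ffun 'I_n -> V})
     (prof_prob p prof * OPT (fun i => val (prof i))).

Definition exp_welfare (n m : nat) (V : finType) (p : 'I_n -> V -> R)
    (val : V -> valuation m) (Seed : finType) (q : Seed -> R)
    (alg : online_alg n m Seed) : R :=
  \big[Rplus/R0]_(prof : {ffun 'I_n -> V})
  \big[Rplus/R0]_(sigma : {perm 'I_n})
  \big[Rplus/R0]_(s : Seed)
     (prof_prob p prof * / INR #|{perm 'I_n}| * q s
       * run_welfare alg s sigma (fun i => val (prof i))).

(* Main.v *)
(* Draw for each arriving buyer [i] fresh valuations of all the other buyers,
   compute an optimal allocation for [v_i] together with these, and let [i] propose
   to the items of her bundle, each weighted by the additive function supporting
   [v_i] on that bundle.  The proposals of distinct buyers are independent, and an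
   item is proposed to by [i] with probability [x_i], where [sum_i x_i <= 1]; the
   expected weights [b_i] of the proposals, summed over buyers and items, give
   [E OPT].  By XOS the welfare is at least the total weight of accepted proposals,
   so it suffices to treat each item separately.

   A proposal is accepted when its weight is at least the price
   [g(S) = (sum_(i in S) b_i) * phi (sum_(i in S) x_i)], where [S] is the set of
   buyers still to arrive and [phi X = (1 - exp (- X)) / X].  Induction on [S] shows
   that the expected weight collected from [S] in random order is at least [g(S)]:
   a threshold rule does at least as well as accepting with probability
   [1 - rho X * x_i], where [phi X = 1 - rho X * X], and for that choice the sum
   over the first buyer [i] in [S] closes up exactly.  Finally
   [phi X >= phi 1 = 1 - 1/e] for [X <= 1]. *)
Require Import Defs.
From Stdlib Require Import Reals Lra ClassicalEpsilon FunctionalExtensionality.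
From mathcomp Require Import all_boot all_order all_algebra perm.
From mathcomp Require Import Rstruct.

Set Implicit Arguments. Unset Strict Implicit. Unset Printing Implicit Defensive.

(** * Inequalities for the exponential, [rho] and [phi] *)

Section Analysis.
Local Open Scope R_scope.

Lemma nondecreasing_from0 (f f' : R -> R) (x : R) :
  (forall t, derivable_pt_lim f t (f' t)) ->
  (forall t, 0 <= t -> 0 <= f' t) -> 0 <= x -> f 0 <= f x.
Proof.
move=> df f'_ge0 [x_gt0 | <-]; last exact: Rle_refl.
have [c [eq_f c_in]] := MVT_cor2 f f' 0 x x_gt0 (fun c _ => df c).
have : 0 <= f' c * (x - 0).
  by apply: Rmult_le_pos; [apply: f'_ge0; lra | lra].
lra.
Qed.

Lemma derivable_pt_lim_exp_scaleN (l t : R) :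
  derivable_pt_lim (fun u => exp (- (l * u))) t (- (l * exp (- (l * t)))).
Proof.
have -> : - (l * exp (- (l * t))) = exp (- (l * t)) * - (l * 1) by ring.
apply: (derivable_pt_lim_comp (fun u => - (l * u)) exp); last exact: derivable_pt_lim_exp.
apply: (derivable_pt_lim_opp (fun u => l * u)).
exact/(derivable_pt_lim_scal id)/derivable_pt_lim_id.
Qed.

(** The difference of the two sides has derivative [l * (exp (- (l * t)) - exp (- t))], nonnegative
    because [l <= 1]. *)
Lemma one_sub_exp_concave (l t : R) :
  0 <= l <= 1 -> 0 <= t -> l * (1 - exp (- t)) <= 1 - exp (- (l * t)).
Proof.
move=> l01 t_ge0.
(* Writing [1 * u] lets [derivable_pt_lim_exp_scaleN] differentiate both terms. *)
pose f u := l * exp (- (1 * u)) - exp (- (l * u)).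
pose f' u := l * - (1 * exp (- (1 * u))) - - (l * exp (- (l * u))).
have: f 0 <= f t.
  apply: (@nondecreasing_from0 f f') => // [u|u u_ge0].
    apply: derivable_pt_lim_minus; last exact: derivable_pt_lim_exp_scaleN.
    exact/derivable_pt_lim_scal/derivable_pt_lim_exp_scaleN.
  rewrite /f'; have : exp (- (1 * u)) <= exp (- (l * u)).
    have: - (1 * u) <= - (l * u) by nra.
    by move=> [/exp_increasing|->]; [lra | exact: Rle_refl].
  by nra.
by rewrite /f !Rmult_0_r Rmult_1_l Ropp_0 exp_0; lra.
Qed.

(** The derivative of the difference is [l] times the slack in [one_sub_exp_concave]. The bound
    amounts to [rho] being nonincreasing on positive reals. *)
Lemma exp_second_order_scale (l t : R) :
  0 <= l <= 1 -> 0 <= t ->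
  l * l * (exp (- t) - 1 + t) <= exp (- (l * t)) - 1 + l * t.
Proof.
move=> l01 t_ge0.
pose f u := (exp (- (l * u)) + l * u) - l * l * (exp (- (1 * u)) + u).
pose f' u := (- (l * exp (- (l * u))) + l * 1) -
             l * l * (- (1 * exp (- (1 * u))) + 1).
have: f 0 <= f t.
  apply: (@nondecreasing_from0 f f') => // [u|u u_ge0].
    apply: derivable_pt_lim_minus.
      apply: derivable_pt_lim_plus; first exact: derivable_pt_lim_exp_scaleN.
      exact/(derivable_pt_lim_scal id)/derivable_pt_lim_id.
    apply: derivable_pt_lim_scal; apply: derivable_pt_lim_plus.
      exact: derivable_pt_lim_exp_scaleN.
    exact: derivable_pt_lim_id.
  have ? := @one_sub_exp_concave l u l01 u_ge0.
  have -> : f' u = l * (1 - exp (- (l * u)) - l * (1 - exp (- u))).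
    by rewrite /f' (Rmult_1_l u); ring.
  by apply: Rmult_le_pos; lra.
by rewrite /f !Rmult_0_r Rmult_1_l Ropp_0 exp_0; lra.
Qed.

Lemma exp_opp_ge_linear (t : R) : 1 - t <= exp (- t).
Proof. by have := exp_ineq1_le (- t); lra. Qed.

Lemma one_sub_inv_exp1_ge0 : 0 <= 1 - / exp 1.
Proof.
have : exp (Ropp 1) < exp 0 by apply: exp_increasing; lra.
by rewrite exp_0 exp_Ropp; lra.
Qed.

(** Serves the endpoint [x = X] of [phi_step]. The derivative of [f] is [1 - (1 + u) * exp (- u)],
    nonnegative by [1 + u <= exp u]. *)
Lemma exp_opp_pade (t : R) : 0 <= t -> 2 - t <= exp (- t) * (t + 2).
Proof.
move=> t_ge0.
pose f u := exp (- (1 * u)) * (u + 2) + u.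
pose f' u := (- (1 * exp (- (1 * u))) * (u + 2) + exp (- (1 * u)) * (1 + 0)) + 1.
have: f 0 <= f t.
  apply: (@nondecreasing_from0 f f') => // [u|u u_ge0].
    apply: derivable_pt_lim_plus; last exact: derivable_pt_lim_id.
    apply: (derivable_pt_lim_mult (fun u => exp (- (1 * u))) (fun u => u + 2)).
      exact: derivable_pt_lim_exp_scaleN.
    apply: (derivable_pt_lim_plus id (fun=> 2)); first exact: derivable_pt_lim_id.
    exact: derivable_pt_lim_const.
  rewrite /f' !Rmult_1_l.
  have e1 : exp (- u) * exp u = 1 by rewrite -exp_plus Rplus_opp_l exp_0.
  have := exp_ineq1_le u; have := exp_pos (- u); nra.
by rewrite /f !Rmult_0_r Rmult_1_l Ropp_0 exp_0; lra.
Qed.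

(** The second-order Taylor remainder of [exp (- X)], normalised by [X^2]. *)
Definition rho (X : R) : R := (exp (- X) - 1 + X) / (X * X).

(* [rho 0] is a junk value, but [phi 0 = 1] is the right limit. *)
Definition phi (X : R) : R := 1 - rho X * X.

Lemma rho_sqr (X : R) : 0 < X -> rho X * (X * X) = exp (- X) - 1 + X.
Proof. by move=> X_gt0; rewrite /rho; field; lra. Qed.

Lemma phi_mul (X : R) : 0 < X -> phi X * X = 1 - exp (- X).
Proof. by move=> X_gt0; have := rho_sqr X_gt0; rewrite /phi; nra. Qed.

Lemma rho_ge0 (X : R) : 0 < X -> 0 <= rho X.
Proof.
move=> X_gt0; apply: Rle_mult_inv_pos; last by nra.
by have := exp_opp_ge_linear X; lra.
Qed.

Lemma phi_ge0 (X : R) : 0 < X -> 0 <= phi X.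
Proof.
move=> X_gt0; have := phi_mul X_gt0.
have : exp (- X) < 1 by rewrite -exp_0; apply: exp_increasing; lra.
nra.
Qed.

Lemma phi_lower_bound (X : R) : 0 <= X <= 1 -> 1 - / exp 1 <= phi X.
Proof.
move=> X01; have inve_gt0 := Rinv_0_lt_compat _ (exp_pos 1).
have [X_gt0 | X_0] : 0 < X \/ 0 = X by lra.
  have := @one_sub_exp_concave X 1 X01 Rle_0_1.
  rewrite Rmult_1_r exp_Ropp => ?; have := phi_mul X_gt0; nra.
by rewrite /phi -X_0 Rmult_0_r; lra.
Qed.

(* For [x < X], after multiplying by [X - x], both sides differ by
   [exp (- (X - x)) * (exp (- x) - (1 - x + rho X * x^2))]. *)
Lemma phi_step (x X : R) : 0 <= x <= X -> 0 < X ->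
  1 - rho X * X - rho X * x <= (1 - x + rho X * (x * x)) * phi (X - x).
Proof.
move=> x_in X_gt0; have rhoE := rho_sqr X_gt0.
have [lt_xX | eq_xX] : x < X \/ x = X by lra.
  set y := X - x; have y_gt0 : 0 < y by rewrite /y; lra.
  have phiE := phi_mul y_gt0.
  have expE : exp (- X) = exp (- x) * exp (- y).
    by rewrite -exp_plus; congr exp; rewrite /y; ring.
  have x_ratio : 0 <= x / X <= 1.
    split; first by apply: Rle_mult_inv_pos; lra.
    by apply: (Rmult_le_reg_r X) => //; rewrite /Rdiv Rmult_assoc Rinv_l; lra.
  (* The ratio [x / X] turns this into [1 - x + rho X * x^2 <= exp (- x)]. *)
  have := @exp_second_order_scale (x / X) X x_ratio (Rlt_le _ _ X_gt0).
  have -> : x / X * X = x by field; lra.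
  have -> : x / X * (x / X) * (exp (- X) - 1 + X) = rho X * (x * x).
    by rewrite -rhoE; field; lra.
  move=> le_a; have ey_gt0 := exp_pos (- y).
  apply: (Rmult_le_reg_r y) => //.
  have : (1 - x + rho X * (x * x)) * exp (- y) <= exp (- x) * exp (- y).
    by apply: Rmult_le_compat_r; lra.
  have -> : (1 - x + rho X * (x * x)) * phi y * y =
            (1 - x + rho X * (x * x)) * (1 - exp (- y)) by rewrite -phiE; ring.
  by rewrite -expE /y; nra.
(* Here [X - x = 0], and [phi 0 = 1] whatever the value of [rho 0]. *)
rewrite eq_xX Rminus_diag /phi Rmult_0_r Rminus_0_r Rmult_1_r rhoE.
apply: (Rmult_le_reg_r X) => //.
have := @exp_opp_pade X (Rlt_le _ _ X_gt0); nra.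
Qed.

End Analysis.

Import Order.TTheory GRing.Theory Num.Theory.
From mathcomp Require Import lra ring.
Local Open Scope ring_scope.
Bind Scope ring_scope with R.
Local Arguments phi X%_ring_scope.

(** Covers [X = 0] uniformly: [r] is [rho X] for [X > 0] and 0 otherwise. The bound [r * X <= 1]
    makes [1 - r * x] a probability for [0 <= x <= X]. *)
Lemma phi_attenuation (X : R) : 0 <= X ->
  exists r : R, [/\ 0 <= r, r * X <= 1, phi X = 1 - r * X &
    forall x : R, 0 <= x <= X ->
      1 - r * X - r * x <= (1 - x + r * (x * x)) * phi (X - x)].
Proof.
rewrite le0r => /orP[/eqP -> | X_gt0].
  have phi0 : phi 0 = 1.
    by apply: etrans (Rminus_0_r 1); congr (Rminus _ _); exact: Rmult_0_r.
  exists 0; split=> [||| x x_in]; rewrite ?mul0r ?phi0 ?subr0 //.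
  have -> : x = 0 by lra.
  by rewrite !subr0 phi0 addr0 mulr1.
have /RltP X_gt0' := X_gt0.
exists (rho X); split=> [||| x /andP[x_ge0 le_xX]].
- exact/RleP/rho_ge0.
- by have /RleP := phi_ge0 X_gt0'; rewrite subr_ge0.
- by [].
- by apply/RleP/phi_step; [split; exact/RleP | ].
Qed.

(** * A single item: the threshold rule against independent proposals *)

Section SingleItem.
Variables (I Om : finType) (P : Om -> R) (D : Om -> option I) (w : Om -> R).
Hypotheses (P_ge0 : forall r, 0 <= P r) (P_sum1 : \sum_r P r = 1)
           (w_ge0 : forall r, 0 <= w r).

(** This and [owner_value] are the [x_i] and [b_i] of the overview. *)
Definition owner_prob (i : I) : R := \sum_(r | D r == Some i) P r.

Definition owner_value (i : I) : R := \sum_(r | D r == Some i) P r * w r.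

Definition price (S : {set I}) : R :=
  (\sum_(i in S) owner_value i) * phi (\sum_(i in S) owner_prob i).

(** Expected weight collected along the order [s]. Each buyer gets a fresh draw from [P], so
    proposals are independent, and the price comes from the buyers after [i]. *)
Fixpoint threshold_value (s : seq I) : R :=
  if s is i :: s' then
    \sum_r P r * (if (D r == Some i) && (price [set k in s'] <= w r)
                  then w r else threshold_value s')
  else 0.

Lemma owner_prob_ge0 i : 0 <= owner_prob i.
Proof. exact: sumr_ge0. Qed.

Lemma owner_value_ge0 i : 0 <= owner_value i.
Proof. by apply: sumr_ge0 => r _; apply: mulr_ge0. Qed.

Lemma sum_owner (F : Om -> R) :
  \sum_i \sum_(r | D r == Some i) F r = \sum_(r | D r) F r.
Proof.
rewrite (exchange_big_dep (fun r => isSome (D r))) /=; last by move=> i r _ /eqP->.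
apply: eq_bigr => r; case Dr: (D r) => [i|] // _.
by rewrite (big_pred1 i) // => k; rewrite eq_sym.
Qed.

Lemma sum_owner_prob_le1 (S : {set I}) : \sum_(i in S) owner_prob i <= 1.
Proof.
apply: (@le_trans _ _ (\sum_i owner_prob i)).
  rewrite [leRHS](bigID (mem S)) /= lerDl.
  by apply: sumr_ge0 => i _; exact: owner_prob_ge0.
rewrite sum_owner -P_sum1 [leRHS](bigID (fun r => isSome (D r))) /= lerDl.
exact: sumr_ge0.
Qed.

Lemma price_ge0 S : 0 <= price S.
Proof.
apply: mulr_ge0; first by apply: sumr_ge0 => i _; exact: owner_value_ge0.
have X_ge0 : 0 <= \sum_(i in S) owner_prob i.
  by apply: sumr_ge0 => i _; exact: owner_prob_ge0.
by have [r [_ rX_le1 -> _]] := phi_attenuation X_ge0; lra.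
Qed.

(** An item has at most one owner, so the total mass lies in [[0, 1]], where [phi] is at least
    [1 - 1/e]. *)
Lemma price_setT : (1 - (exp 1)^-1) * (\sum_(r | D r) P r * w r) <= price [set: I].
Proof.
rewrite -sum_owner mulrC /price.
rewrite [in leRHS](eq_bigl xpredT) => [|i]; last by rewrite inE.
apply: ler_wpM2l; first by apply: sumr_ge0 => i _; exact: owner_value_ge0.
apply/RleP/phi_lower_bound; split; apply/RleP.
  by apply: sumr_ge0 => i _; exact: owner_prob_ge0.
exact: sum_owner_prob_le1.
Qed.

(* The maximum of [w] and the price dominates accepting with probability [t]. *)
Lemma threshold_step_ge (i : I) (c t : R) : 0 <= c -> 0 <= t <= 1 ->
  c + t * (owner_value i - owner_prob i * c) <=
  \sum_r P r * (if (D r == Some i) && (c <= w r) then w r else c).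
Proof.
move=> c_ge0 t01.
have -> : c + t * (owner_value i - owner_prob i * c) =
          \sum_r P r * (c + if D r == Some i then t * (w r - c) else 0).
  under [RHS]eq_bigr do rewrite mulrDr.
  rewrite big_split /= -mulr_suml P_sum1 mul1r; congr (_ + _).
  rewrite /owner_value /owner_prob mulr_suml -sumrB mulr_sumr big_mkcond /=.
  by apply: eq_bigr => r _; case: ifP => _; rewrite ?mulr0 //; ring.
apply: ler_sum => r _; apply: ler_wpM2l => //.
case: ifP => _ /=; last by rewrite addr0.
by case: ifP => [le_cw|/negbT]; rewrite -?ltNge => *; nra.
Qed.

Lemma price_step (S : {set I}) :
  #|S|%:R * price S <=
  \sum_(i in S) \sum_r P r * (if (D r == Some i) && (price (S :\ i) <= w r)
                              then w r else price (S :\ i)).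
Proof.
set X : R := \sum_(i in S) owner_prob i; set B : R := \sum_(i in S) owner_value i.
have X_ge0 : 0 <= X by apply: sumr_ge0 => i _; exact: owner_prob_ge0.
have [r [r_ge0 rX_le1 phiX step]] := phi_attenuation X_ge0.
have XD i : i \in S -> \sum_(k in S :\ i) owner_prob k = X - owner_prob i.
  by move=> iS; rewrite /X (big_setD1 i iS) /= [RHS]addrAC subrr add0r.
have BD i : i \in S -> \sum_(k in S :\ i) owner_value k = B - owner_value i.
  by move=> iS; rewrite /B (big_setD1 i iS) /= [RHS]addrAC subrr add0r.
have ler_X i : i \in S -> owner_prob i <= X.
  move=> iS; rewrite -subr_ge0 -XD //.
  by apply: sumr_ge0 => k _; exact: owner_prob_ge0.
have ler_B i : i \in S -> owner_value i <= B.
  move=> iS; rewrite -subr_ge0 -BD //.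
  by apply: sumr_ge0 => k _; exact: owner_value_ge0.
(* The middle sum comes from [t = 1 - r * x_i] in [threshold_step_ge] and the last clause of
   [phi_attenuation]. *)
apply: (@le_trans _ _ (\sum_(i in S)
    ((1 - r * X - r * owner_prob i) * (B - owner_value i)
     + (1 - r * owner_prob i) * owner_value i))).
  (* Summed over [S], the last two terms give [- r * B * X] and [r * X * B], which cancel. *)
  have -> : \sum_(i in S) ((1 - r * X - r * owner_prob i) * (B - owner_value i)
              + (1 - r * owner_prob i) * owner_value i) =
            \sum_(i in S) ((1 - r * X) * B + (- (r * B) * owner_prob i
              + r * X * owner_value i)).
    by apply: eq_bigr => i _; ring.
  rewrite 2!big_split /= sumr_const -!mulr_sumr -/X -/B /price -/X -/B phiX.
  rewrite -[_ * B *+ _]mulr_natl le_eqVlt; apply/orP; left; apply/eqP.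
  by ring.
apply: ler_sum => i iS.
have x_ge0 := owner_prob_ge0 i; have b_ge0 := owner_value_ge0 i.
have {}ler_X := ler_X i iS; have {}ler_B := ler_B i iS.
have t01 : 0 <= 1 - r * owner_prob i <= 1 by nra.
apply: le_trans (threshold_step_ge i (price_ge0 (S :\ i)) t01).
have /step stepi : 0 <= owner_prob i <= X by rewrite x_ge0.
rewrite /price XD // BD //.
move: stepi; set f := phi _; set x := owner_prob i; set b := owner_value i.
(* The price is retained with weight [1 - t * x = 1 - x + r * x^2], the coefficient bounded in
   [stepi]. *)
move=> stepi; have : 0 <= (B - b) * ((1 - x + r * (x * x)) * f - (1 - r * X - r * x)).
  by apply: mulr_ge0; rewrite subr_ge0.
by nra.
Qed.

(** Split the orders by their first buyer [i]. After a rejection the tails average to at least the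
    price of [S :\ i] by induction, and [price_step] averages over [i]. *)
Lemma sum_threshold_value_permutations (s : seq I) : uniq s ->
  (size s)`!%:R * price [set k in s] <=
  \sum_(t <- permutations s) threshold_value t.
Proof.
have [n] := ubnP (size s); elim: n s => // n IHn s le_sn Us.
have [s0 | s_gt0] := posnP (size s).
  rewrite (size0nil s0) /= big_seq1 /price /=.
  by rewrite big1 ?mul0r ?mulr0 // => i; rewrite inE in_nil.
rewrite (perm_big _ (permutationsE s_gt0)) /= big_allpairs_dep /= undup_id //.
have -> : (size s)`! = ((size s).-1`! * #|[set k in s]|)%N.
  by rewrite cardsE (card_uniqP Us) -(prednK s_gt0) factS mulnC.
rewrite natrM -mulrA.
apply: (@le_trans _ _ _ _ _ (ler_wpM2l (ler0n _ _) (price_step _))).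
rewrite mulr_sumr -(@big_filter _ _ _ _ (index_enum I)) /=.
rewrite (@perm_big _ _ _ _ _ s) /=; last first.
  apply: uniq_perm => //; first by rewrite filter_uniq // index_enum_uniq.
  by move=> i; rewrite mem_filter mem_index_enum inE andbT.
rewrite [leLHS]big_seq [leRHS]big_seq; apply: ler_sum => i i_s.
have size_rem : size (rem i s) = (size s).-1 by rewrite size_rem.
have Urem : uniq (rem i s) by exact: rem_uniq.
have set_rem : [set k in rem i s] = [set k in s] :\ i.
  by apply/setP => k; rewrite !inE (mem_rem_uniq _ Us) !inE.
have IHi := IHn (rem i s) _ Urem; rewrite size_rem set_rem in IHi.
rewrite [leRHS]big_seq.
(* The price facing [i] depends only on the set of later buyers, hence not on the tail [t]. *)
under [leRHS]eq_bigr => t t_rem.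
  rewrite (_ : [set k in t] = [set k in s] :\ i); last first.
    rewrite -set_rem; apply/setP => k; rewrite !inE.
    by move: t_rem; rewrite mem_permutations => /perm_mem.
  over.
rewrite -big_seq exchange_big mulr_sumr; apply: ler_sum => r _.
rewrite -mulr_sumr mulrCA; apply: ler_wpM2l => //.
case: ifP => _; last by apply: IHi; rewrite prednK.
by rewrite big_const_seq count_predT size_permutations // size_rem iter_addr_0 mulr_natl.
Qed.

End SingleItem.

(** * Product distributions and resampling of one coordinate *)

Section Product.
Variables (I T : finType) (P : I -> T -> R).
Hypothesis P_sum1 : forall i, \sum_x P i x = 1.

Definition prod_prob (r : {ffun I -> T}) : R := \prod_i P i (r i).

Definition upd (r : {ffun I -> T}) (i : I) (x : T) : {ffun I -> T} :=
  [ffun k => if k == i then x else r k].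

Lemma updE r i x k : upd r i x k = if k == i then x else r k.
Proof. by rewrite ffunE. Qed.

Lemma upd_upd r i x y : upd (upd r i x) i y = upd r i y.
Proof. by apply/ffunP => k; rewrite !ffunE; case: eqP. Qed.

Lemma upd_id r i : upd r i (r i) = r.
Proof. by apply/ffunP => k; rewrite ffunE; case: eqP => [->|]. Qed.

Lemma prod_prob_sum1 : \sum_r prod_prob r = 1.
Proof.
by rewrite /prod_prob -(bigA_distr_bigA P) /= big1.
Qed.

Lemma prod_prob_ge0 r : (forall i x, 0 <= P i x) -> 0 <= prod_prob r.
Proof. by move=> P_ge0; apply: prodr_ge0. Qed.

Lemma prod_prob_swap i r x :
  prod_prob (upd r i x) * P i (r i) = prod_prob r * P i x.
Proof.
rewrite /prod_prob (bigD1 i) //= [in RHS](bigD1 i) //= updE eqxx.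
rewrite (eq_bigr (fun k => P k (r k))); last first.
  by move=> k /negPf neq_ki; rewrite updE neq_ki.
by ring.
Qed.

(** Exchanging [r i] with the fresh [x] is an involution that preserves the joint weight
    [prod_prob r * P i x]. *)
Lemma sum_prod_prob_resample i (F : {ffun I -> T} -> R) :
  \sum_r \sum_x prod_prob r * P i x * F (upd r i x) = \sum_r prod_prob r * F r.
Proof.
pose swap (rx : {ffun I -> T} * T) := (upd rx.1 i rx.2, rx.1 i).
have swapK : involutive swap.
  by case=> r x; rewrite /swap /= upd_upd upd_id updE eqxx.
rewrite pair_bigA (reindex_inj (inv_inj swapK)) /=.
rewrite -(pair_bigA _ (fun r x =>
  prod_prob (upd r i x) * P i (r i) * F (upd (upd r i x) i (r i)))) /=.
apply: eq_bigr => r _.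
under eq_bigr do rewrite upd_upd upd_id prod_prob_swap mulrAC.
by rewrite -mulr_sumr P_sum1 mulr1.
Qed.

End Product.

(** * Arrival orders: from permutations to lists *)

Lemma sum_perm_permutations n (F : seq 'I_n -> R) :
  \sum_(sigma : {perm 'I_n}) F (map sigma (enum 'I_n)) =
  \sum_(t <- permutations (enum 'I_n)) F t.
Proof.
pose f (sigma : {perm 'I_n}) := map sigma (enum 'I_n).
rewrite -[LHS](@big_map _ _ _ _ _ f _ xpredT F) /=.
apply: perm_big.
have f_inj : injective f.
  move=> s1 s2 /eq_in_map eq_s; apply/permP => i.
  by apply: eq_s; rewrite mem_enum.
have f_perm s : f s \in permutations (enum 'I_n).
  rewrite mem_permutations; apply: uniq_perm; rewrite ?enum_uniq //.
    by rewrite map_inj_uniq ?enum_uniq //; exact: perm_inj.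
  move=> i; rewrite mem_enum; apply/mapP; exists ((s^-1)%g i).
    by rewrite mem_enum.
  by rewrite permKV.
have f_uniq : uniq (map f (index_enum {perm 'I_n})).
  by rewrite map_inj_uniq // index_enum_uniq.
have f_sub : {subset map f (index_enum {perm 'I_n}) <= permutations (enum 'I_n)}.
  by move=> _ /mapP[s _ ->].
(* Both lists have [n!] entries, so the injection [f] is onto. *)
have size_f : (size (permutations (enum 'I_n)) <= size (map f (index_enum {perm 'I_n})))%N.
  rewrite size_permutations ?enum_uniq // size_enum_ord size_map.
  by rewrite -card_Sn cardT enumT.
have [_ eq_mem] := uniq_min_size f_uniq f_sub size_f.
exact: uniq_perm f_uniq (permutations_uniq _) eq_mem.
Qed.

(** * Choice of optimal allocations and supporting additive functions *)

Section Allocation.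
Variables (n m : nat).

Definition bundle (a : {ffun 'I_m -> option 'I_n}) (i : 'I_n) : {set 'I_m} :=
  [set j | a j == Some i].

Lemma XOS_ge0 (v : valuation m) S : XOS v -> 0 <= v S.
Proof.
move=> [ws [_ [ws_ge0 ws_max]]]; have [_ [w w_in <-]] := ws_max S.
by apply: sumr_ge0 => j _; apply/RleP/ws_ge0.
Qed.

(** The XOS hypothesis stands under the existential so that [epsilon] has a witness for every
    profile, even one outside the support. *)
Lemma OPT_attained (vals : 'I_n -> valuation m) :
  exists a : {ffun 'I_m -> option 'I_n},
  (forall i, XOS (vals i)) -> OPT vals <= \sum_i vals i (bundle a i).
Proof.
have [xos|?] := classic (forall i, XOS (vals i)); last by exists [ffun=> None].
suff [a OPT_a] : exists a, OPT vals <= \sum_i vals i (bundle a i) by exists a.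
rewrite /OPT; elim/big_rec: _ => [|a x _ [b le_xb]].
  (* The default 0 of the maximum is covered by the empty allocation. *)
  by exists [ffun=> None]; apply: sumr_ge0 => i _; exact: XOS_ge0.
case: (Rmax_case_strong (\sum_i vals i (bundle a i)) x
         (fun y => exists a, y <= \sum_i vals i (bundle a i)) _ _) => //.
- by move=> _; exists a.
- by move=> _; exists b.
- by move=> c; exists c.
Qed.

Definition best (vals : 'I_n -> valuation m) : {ffun 'I_m -> option 'I_n} :=
  epsilon (inhabits [ffun=> None]) (fun a =>
    (forall i, XOS (vals i)) -> OPT vals <= \sum_i vals i (bundle a i)).

Lemma bestP vals : (forall i, XOS (vals i)) ->
  OPT vals <= \sum_i vals i (bundle (best vals) i).
Proof. exact: (epsilon_spec _ _ (OPT_attained vals)). Qed.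

(** Nonnegativity is unconditional, so that [weight] is nonnegative on all profiles. *)
Definition supports (v : valuation m) (S : {set 'I_m}) (w : 'I_m -> R) : Prop :=
  (forall j, 0 <= w j) /\
  (XOS v -> (forall B : {set 'I_m}, \sum_(j in B) w j <= v B) /\ \sum_(j in S) w j = v S).

Definition support (v : valuation m) S : 'I_m -> R :=
  epsilon (inhabits (fun=> 0)) (supports v S).

Lemma supportP v S : supports v S (support v S).
Proof.
apply: epsilon_spec; have [xos|nxos] := classic (XOS v); last first.
  by exists (fun=> 0).
have [ws [_ [ws_ge0 ws_max]]] := xos; have [_ [w w_in w_eq]] := ws_max S.
exists w; split=> [j|_]; first exact/RleP/ws_ge0.
by split=> // B; apply/RleP; have [+ _] := ws_max B; apply.
Qed.

End Allocation.

(** * The resampling algorithm and its expected welfare *)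

Section Algorithm.
Variables (n m : nat) (V : finType) (val : V -> valuation m) (p : 'I_n -> V -> R).
Hypotheses (p_ge0 : forall i x, 0 <= p i x) (p_sum1 : forall i, \sum_x p i x = 1).

Local Notation Om := {ffun 'I_n -> V}.
Local Notation P := (prod_prob p).
Local Notation Q := (prod_prob (fun _ : 'I_n => P)).

Definition owner (j : 'I_m) (r : Om) : option 'I_n := best (fun k => val (r k)) j.

Definition weight (j : 'I_m) (r : Om) : R :=
  if owner j r is Some i
  then support (val (r i)) (bundle (best (fun k => val (r k))) i) j else 0.

Definition item_price (j : 'I_m) : {set 'I_n} -> R :=
  price P (owner j) (weight j).

Definition accepts (j : 'I_m) (i : 'I_n) (r : Om) (S : {set 'I_n}) : bool :=
  (owner j r == Some i) && (item_price j S <= weight j r).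

(** The seed holds one sampled profile [s i] per buyer, whose coordinate [i] is overwritten by the
    revealed [v]. The priced set consists of the buyers still to come. *)
Definition resampling_alg : online_alg n m {ffun 'I_n -> Om} :=
  fun s h i v rem =>
    let S := bundle (best (fun k => if k == i then v else val (s i k))) i in
    [set j in S | item_price j [set k | (k != i) && (k \notin unzip1 h)]
                  <= support v S j].

(** The weight of the first accepted proposal for [j] along [L]. *)
Fixpoint gain (j : 'I_m) (prof : Om) (s : {ffun 'I_n -> Om}) (L : seq 'I_n) : R :=
  if L is i :: L' then
    let r := upd (s i) i (prof i) in
    if accepts j i r [set k in L'] then weight j r else gain j prof s L'
  else 0.

Lemma weight_ge0 j r : 0 <= weight j r.
Proof. by rewrite /weight; case: owner => // i; exact: (proj1 (supportP _ _)). Qed.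

Lemma P_ge0 r : 0 <= P r.
Proof. exact: prod_prob_ge0. Qed.

Lemma P_sum1 : \sum_r P r = 1.
Proof. exact: prod_prob_sum1. Qed.

Lemma Q_ge0 s : 0 <= Q s.
Proof. by apply: prod_prob_ge0 => _; exact: P_ge0. Qed.

Lemma Q_sum1 : \sum_s Q s = 1.
Proof. by apply: prod_prob_sum1 => _; exact: P_sum1. Qed.

Lemma resampling_algE s h i (prof : Om) rem j :
  (j \in resampling_alg s h i (val (prof i)) rem) =
  accepts j i (upd (s i) i (prof i)) [set k | (k != i) && (k \notin unzip1 h)].
Proof.
rewrite /resampling_alg /accepts /weight /owner !inE.
have -> : (fun k => if k == i then val (prof i) else val (s i k)) =
          (fun k => val (upd (s i) i (prof i) k)).
  by apply: functional_extensionality => k; rewrite updE; case: ifP.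
by case: eqP => //= ->; rewrite updE eqxx.
Qed.

Lemma accepted_weight s i (prof : Om) S j :
  let r := upd (s i) i (prof i) in
  accepts j i r S ->
  weight j r = support (val (prof i)) (bundle (best (fun k => val (r k))) i) j.
Proof. by move=> r /andP[/eqP ow _]; rewrite /weight ow /r updE eqxx. Qed.

(** Loop invariant: the history is the complement of the buyers to come, and each unassigned item
    still promises its gain from them. *)
Lemma run_ge_gain (prof : Om) s (sigma : {perm 'I_n}) (K : seq 'I_n)
    (h : history n m) (rem : {set 'I_m}) (acc : R) :
  (forall i, XOS (val (prof i))) -> uniq (map sigma K) ->
  (forall k, (k \in unzip1 h) = (k \notin map sigma K)) ->
  acc + \sum_(j in rem) gain j prof s (map sigma K) <=
  (foldl (run_step resampling_alg s sigma (fun i => val (prof i)))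
     (h, rem, acc) K).2.
Proof.
move=> xos; elim: K h rem acc => [|k K IHK] h rem acc /=.
  by move=> _ _; rewrite big1 // addr0.
set i := sigma k => /andP[iNK UK] hE.
have restE : [set l | (l != i) && (l \notin unzip1 h)] = [set l in map sigma K].
  apply/setP => l; rewrite !inE hE negbK inE.
  by case: eqP => //= ->; rewrite (negPf iNK).
set B := (resampling_alg _ _ _ _ _ :&: rem).
set r := upd (s i) i (prof i).
have inB j : (j \in B) = (j \in rem) && accepts j i r [set l in map sigma K].
  by rewrite inE resampling_algE restE andbC.
apply: le_trans (IHK _ _ _ UK _); last first.
  move=> l; rewrite /unzip1 map_rcons mem_rcons inE /= -/(unzip1 h) hE inE.
  by case: eqP => [->|] //=; rewrite iNK.
rewrite -addrA lerD2l (bigID (fun j => accepts j i r [set l in map sigma K])) /=.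
apply: lerD.
  (* [B] may be only part of the sampled optimal bundle, but the supporting function bounds [v] from
     below on every set. *)
  have [_ /(_ (xos i)) [/(_ B) supp_le _]] :=
    supportP (val (prof i)) (bundle (best (fun k => val (r k))) i).
  apply: le_trans supp_le.
  rewrite (eq_bigl (fun j => j \in B)) => [|j]; last by rewrite inB.
  apply: ler_sum => j; rewrite inB => /andP[_ acc_j].
  by rewrite acc_j (accepted_weight acc_j).
rewrite (eq_bigl (fun j => j \in rem :\: B)) => [|j]; last first.
  by rewrite [RHS]in_setD inB; case: (j \in rem); case: accepts.
apply: ler_sum => j; rewrite in_setD inB negb_and.
by case: (j \in rem) => //=; rewrite andbT => /negPf ->.
Qed.

Lemma gain_upd j (prof : Om) s L i x r : i \notin L ->
  gain j (upd prof i x) (upd s i r) L = gain j prof s L.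
Proof.
elim: L => //= k L IHL; rewrite inE negb_or => /andP[neq_ik /IHL ->].
by rewrite !updE eq_sym (negPf neq_ik).
Qed.

(** The proposal of [i] reads only coordinate [i] of [prof] and of [s], so it is independent of
    later proposals; its profile has law [P]. *)
Lemma expected_gain j L : uniq L ->
  \sum_prof \sum_s P prof * Q s * gain j prof s L =
  threshold_value P (owner j) (weight j) L.
Proof.
elim: L => [|i L IHL] /=.
  by rewrite big1 // => prof _; rewrite big1 // => s _; rewrite mulr0.
move=> /andP[iNL UL]; rewrite -{}IHL //.
pose c y r := if accepts j i r [set k in L] then weight j r else y.
transitivity (\sum_prof \sum_s P prof * Q s * \sum_r P r * c (gain j prof s L) r).
  under eq_bigr do (under eq_bigr do rewrite -mulrA; rewrite -mulr_sumr).
  (* Coordinate [i] is resampled in [prof] and then in [s]; by [gain_upd] this leaves the gain of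
     the tail unchanged. *)
  rewrite -(sum_prod_prob_resample p_sum1 i).
  apply: eq_bigr => prof _.
  under eq_bigr => x _.
    rewrite -(sum_prod_prob_resample (fun=> P_sum1) i).
    under eq_bigr => s _.
      under eq_bigr => r _.
        rewrite !updE eqxx gain_upd // -/(c _ _).
        over.
      over.
    over.
  rewrite /=; under eq_bigr do rewrite mulr_sumr.
  rewrite exchange_big; apply: eq_bigr => s _ /=.
  (* A [P]-distributed profile with coordinate [i] replaced by an independent draw from [p i] is
     again [P]-distributed. *)
  rewrite -(sum_prod_prob_resample p_sum1 i) exchange_big mulr_sumr /=.
  apply: eq_bigr => x _; rewrite !mulr_sumr; apply: eq_bigr => r _.
  by ring.
transitivity (\sum_prof \sum_r \sum_s P prof * Q s * (P r * c (gain j prof s L) r)).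
  apply: eq_bigr => prof _; rewrite [RHS]exchange_big; apply: eq_bigr => s _.
  by rewrite mulr_sumr.
rewrite exchange_big /=; apply: eq_bigr => r _.
under eq_bigr do under eq_bigr do rewrite mulrCA.
under eq_bigr do rewrite -mulr_sumr.
rewrite -mulr_sumr; congr (_ * _); rewrite /c /accepts /item_price.
case: ifP => // _.
under eq_bigr do rewrite -mulr_suml -mulr_sumr Q_sum1 mulr1.
by rewrite -mulr_suml P_sum1 mul1r.
Qed.

Lemma prob0_or_XOS (xos : forall i x, 0 < p i x -> XOS (val x)) (r : Om) :
  P r = 0 \/ forall i, XOS (val (r i)).
Proof.
have [/forallP r_gt0|] := boolP [forall i, 0 < p i (r i)].
  by right=> i; apply: xos (r_gt0 i).
rewrite negb_forall => /existsP[i]; rewrite lt0r p_ge0 andbT negbK => /eqP pi0.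
by left; rewrite /prod_prob (bigD1 i) //= pi0 mul0r.
Qed.

(** On each profile the supporting functions are exact on the bundles of [best], so its value splits
    into item weights. *)
Lemma exp_OPT_le (xos : forall i x, 0 < p i x -> XOS (val x)) :
  exp_OPT p val <= \sum_j \sum_(r | owner j r) P r * weight j r.
Proof.
rewrite (exchange_big_dep xpredT) //=; apply: ler_sum => r _.
rewrite -mulr_sumr -[prof_prob p r]/(P r).
have [->|r_xos] := prob0_or_XOS xos r; first by rewrite RmultE !mul0r.
apply: ler_wpM2l; first exact: P_ge0.
apply: le_trans (bestP r_xos) _; set a := best _.
have supp i : val (r i) (bundle a i) = \sum_(j in bundle a i) weight j r.
  have [_ /(_ (r_xos i)) [_ <-]] := supportP (val (r i)) (bundle a i).
  by apply: eq_bigr => j; rewrite inE /weight /owner -/a => /eqP ->.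
under eq_bigr do rewrite supp.
rewrite (exchange_big_dep xpredT) //= [leRHS]big_mkcond /=.
apply: ler_sum => j _; rewrite /owner -/a.
case aj: (a j) => [i|] /=; last by rewrite big_pred0 // => i; rewrite inE aj.
by rewrite (big_pred1 i) // => k; rewrite inE aj eq_sym.
Qed.

Lemma exp_welfare_ge (xos : forall i x, 0 < p i x -> XOS (val x)) :
  \sum_j item_price j [set: 'I_n] <= exp_welfare p val Q resampling_alg.
Proof.
have N_gt0 : 0 < (n`!)%:R :> R by rewrite ltr0n fact_gt0.
(* Each run is bounded below by its gains; profiles of probability zero contribute 0. *)
apply: (@le_trans _ _ (\sum_prof \sum_(sigma : {perm 'I_n}) \sum_s
    P prof * (n`!)%:R^-1 * Q s *
    \sum_j gain j prof s (map sigma (enum 'I_n)))); last first.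
  apply: ler_sum => prof _; apply: ler_sum => sigma _; apply: ler_sum => s _.
  rewrite -[prof_prob p prof]/(P prof) INRE card_Sn.
  have [->|prof_xos] := prob0_or_XOS xos prof.
    by rewrite !RmultE !mul0r.
  apply: ler_wpM2l.
    by rewrite !mulr_ge0 ?invr_ge0 ?P_ge0 ?Q_ge0 // ltW.
  rewrite -[leLHS]add0r (eq_bigl (fun j => j \in [set: 'I_m])) => [|j]; last first.
    by rewrite inE.
  apply: run_ge_gain => // [|k].
    by rewrite map_inj_uniq ?enum_uniq //; exact: perm_inj.
  rewrite in_nil; apply/esym/negbF/mapP; exists ((sigma^-1)%g k).
    by rewrite mem_enum.
  by rewrite permKV.
(* Linearity of expectation isolates each item. *)
have -> : \sum_prof \sum_(sigma : {perm 'I_n}) \sum_s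
    P prof * (n`!)%:R^-1 * Q s * \sum_j gain j prof s (map sigma (enum 'I_n)) =
  \sum_j (n`!)%:R^-1 * \sum_(sigma : {perm 'I_n})
    \sum_prof \sum_s P prof * Q s * gain j prof s (map sigma (enum 'I_n)).
  under [RHS]eq_bigr do rewrite exchange_big mulr_sumr.
  rewrite [RHS]exchange_big; apply: eq_bigr => prof _ /=.
  under [RHS]eq_bigr do rewrite mulr_sumr.
  rewrite [RHS]exchange_big; apply: eq_bigr => sigma _ /=.
  under [RHS]eq_bigr do rewrite mulr_sumr.
  rewrite [RHS]exchange_big; apply: eq_bigr => s _ /=.
  by rewrite mulr_sumr; apply: eq_bigr => j _; ring.
apply: ler_sum => j _; rewrite mulrC ler_pdivlMr //.
under eq_bigr => sigma _.
  rewrite expected_gain; first over.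
  by rewrite map_inj_uniq ?enum_uniq //; exact: perm_inj.
rewrite (sum_perm_permutations (threshold_value P (owner j) (weight j))).
have := @sum_threshold_value_permutations _ _ P (owner j) (weight j)
  P_ge0 P_sum1 (weight_ge0 j) (enum 'I_n) (enum_uniq _).
rewrite size_enum_ord mulrC.
suff -> : [set k in enum 'I_n] = [set: 'I_n] by [].
by apply/setP => k; rewrite !inE mem_enum.
Qed.

End Algorithm.

Theorem theorem2 (n m : nat) (V : finType) (val : V -> valuation m)
    (p : 'I_n -> V -> R)
    (Hp0 : forall i x, Rle R0 (p i x))
    (Hp1 : forall i, \big[Rplus/R0]_(x : V) p i x = R1)
    (Hxos : forall i x, Rlt R0 (p i x) -> XOS (val x)) :
  exists (Seed : finType) (q : Seed -> R) (alg : online_alg n m Seed),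
    (forall s, Rle R0 (q s)) /\
    \big[Rplus/R0]_(s : Seed) q s = R1 /\
    Rle (Rmult (Rminus R1 (Rinv (exp R1))) (exp_OPT p val)) (exp_welfare p val q alg).
Proof.
have p_ge0 i x : 0 <= p i x by exact/RleP/Hp0.
have xos i x : 0 < p i x -> XOS (val x) by move/RltP; exact: Hxos.
exists {ffun 'I_n -> {ffun 'I_n -> V}}, (prod_prob (fun=> prod_prob p)).
exists (resampling_alg val p); split=> [s|]; first exact/RleP/Q_ge0.
split; first exact: Q_sum1.
apply/RleP; apply: le_trans (exp_welfare_ge p_ge0 Hp1 xos).
have /RleP inve_le1 := one_sub_inv_exp1_ge0.
apply: le_trans (ler_wpM2l inve_le1 (exp_OPT_le p_ge0 xos)) _.
rewrite mulr_sumr; apply: ler_sum => j _.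
by apply: price_setT => [r||r]; [exact: P_ge0 | exact: P_sum1 | exact: weight_ge0].
Qed.
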